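(* (Associativity) Let $D$ be a design, $y_1,\dots,y_n$ distinct variables and $N_1,\dots,N_n$ negative designs. Then $$[\![D[N_1/y_1,\dots,N_n/y_n]]\!] = [\![\,[\![D]\!][\,[\![N_1]\!]/y_1,\dots,[\![N_n]\!]/y_n]\,]\!].$$
   Context: Fix a signature: a set $A$ of names with an arity function $\mathsf{ar}:A\to\mathbb{N}$, and a countable set of variables. Designs are the possibly infinite terms coinductively generated by: positive designs $P ::= \Omega \mid \bigwedge\{S_i : i\in I\}$ ($I$ an arbitrary index set); predesigns $S ::= N_0\,|\,\overline{a}\langle N_1,\dots,N_n\rangle$ with $\mathsf{ar}(a)=n$; negative designs $N ::= x \mid \sum a(\vec x).P_a$, where the formal sum has exactly one component $a(\vec x).P_a$ for each name $a\in A$, $\vec x$ a list of $\mathsf{ar}(a)$ distinct variables bound in $P_a$. A design is either a positive design, a predesign or a negative design. Designs are identified up to renaming of bound variables and up to treating conjunctions as sets (coinductive equivalence in which two conjunctions are equivalent when every conjunct of each is equivalent to some conjunct of the other). A unary conjunction $\bigwedge\{S\}$ is identified with $S$, and $\maltese:=\bigwedge\emptyset$. Write $S\in P$ if $P$ is a conjunction and $S$ one of its conjuncts. A predesign $(\sum a(\vec x).P_a)\,|\,\overline{b}\langle\vec N\rangle$ is a cut. $D[\vec N/\vec y]$ is capture-avoiding simultaneous substitution. Reduction: $P\rightsquigarrow Q$ iff some cut $(\sum a(\vec x).P_a)\,|\,\overline b\langle\vec N\rangle\in P$ and $Q=P_b[\vec N/\vec x]$; $\rightsquigarrow^*$ is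 its reflexive-transitive closure. Normal form, defined corecursively: $[\![P]\!]=\Omega$ if there is an infinite reduction sequence from $P$ or a reduction sequence from $P$ ending in $\Omega$; otherwise $[\![P]\!]=\bigwedge\{x\,|\,\overline a\langle [\![N_1]\!],\dots,[\![N_n]\!]\rangle : P\rightsquigarrow^* Q,\ x|\overline a\langle N_1,\dots,N_n\rangle\in Q\}$; $[\![\sum a(\vec x).P_a]\!]=\sum a(\vec x).[\![P_a]\!]$; $[\![x]\!]=x$. *)

(* Defs.v *)
From mathcomp Require Import all_boot.
From mathcomp Require Import boolp.
From Stdlib Require Import Relation_Operators.

Set Implicit Arguments.
Unset Strict Implicit.
Unset Printing Implicit Defensive.

Record signature := Signature { name :> Type; ar : name -> nat }.

(* Designs modulo renaming of bound variables, as de Bruijn terms.  In the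
   component [a(x_0, ..., x_{k-1}).P_a] of a sum, k = ar a, the index i < k
   stands for x_i inside P_a, and the index k + j stands for the variable j of
   the context of the sum.  At top level, indices are the names of the free
   variables. *)
CoInductive positive (A : signature) : Type :=
| Omega
| Conj (I : Type) (S : I -> predesign A)
with predesign (A : signature) : Type :=
| Pre (N0 : negative A) (a : A) (N : 'I_(ar a) -> negative A)
with negative (A : signature) : Type :=
| Var (x : nat)
| Sum (P : forall a : A, positive A).

Arguments Omega {A}.
Arguments Conj {A} I S.
Arguments Pre {A} N0 a N.
Arguments Var {A} x.
Arguments Sum {A} P.

Definition up_ren (k : nat) (r : nat -> nat) (x : nat) : nat :=
  if x < k then x else k + r (x - k).

CoFixpoint ren_pos (A : signature) (r : nat -> nat) (P : positive A)
    : positive A :=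
  match P with
  | Omega => Omega
  | Conj J T => Conj J (fun i => ren_pre r (T i))
  end
with ren_pre (A : signature) (r : nat -> nat) (S : predesign A)
    : predesign A :=
  match S with
  | Pre N0 a N => Pre (ren_neg r N0) a (fun k => ren_neg r (N k))
  end
with ren_neg (A : signature) (r : nat -> nat) (N : negative A)
    : negative A :=
  match N with
  | Var x => Var (r x)
  | Sum P => Sum (fun a => ren_pos (up_ren (ar a) r) (P a))
  end.

Definition up_subst (A : signature) (k : nat) (s : nat -> negative A)
    (x : nat) : negative A :=
  if x < k then Var x else ren_neg (addn k) (s (x - k)).

CoFixpoint subst_pos (A : signature) (s : nat -> negative A)
    (P : positive A) : positive A :=
  match P with
  | Omega => Omega
  | Conj J T => Conj J (fun i => subst_pre s (T i))
  end
with subst_pre (A : signature) (s : nat -> negative A) (S : predesign A)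
    : predesign A :=
  match S with
  | Pre N0 a N => Pre (subst_neg s N0) a (fun k => subst_neg s (N k))
  end
with subst_neg (A : signature) (s : nat -> negative A) (N : negative A)
    : negative A :=
  match N with
  | Var x => s x
  | Sum P => Sum (fun a => subst_pos (up_subst (ar a) s) (P a))
  end.

(* The substitution [N_0/y_0, ..., N_{n-1}/y_{n-1}] of free variables. *)
Definition simul (A : signature) (n : nat) (y : 'I_n -> nat)
    (N : 'I_n -> negative A) (x : nat) : negative A :=
  if [pick i | y i == x] is Some i then N i else Var x.

(* The substitution [N_0/x_0, ..., N_{k-1}/x_{k-1}] of the variables of a
   binder that is being removed. *)
Definition inst (A : signature) (k : nat) (N : 'I_k -> negative A)
    (x : nat) : negative A :=
  if insub x is Some i then N i else Var (x - k).

(* Equality of designs: conjunctions are compared as sets. *)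
CoInductive eq_pos (A : signature) : positive A -> positive A -> Prop :=
| eq_Omega : eq_pos Omega Omega
| eq_Conj (I J : Type) (S : I -> predesign A) (T : J -> predesign A) :
    (forall i, exists j, eq_pre (S i) (T j)) ->
    (forall j, exists i, eq_pre (S i) (T j)) ->
    eq_pos (Conj I S) (Conj J T)
with eq_pre (A : signature) : predesign A -> predesign A -> Prop :=
| eq_Pre (N0 M0 : negative A) (a : A) (N M : 'I_(ar a) -> negative A) :
    eq_neg N0 M0 -> (forall k, eq_neg (N k) (M k)) ->
    eq_pre (Pre N0 a N) (Pre M0 a M)
with eq_neg (A : signature) : negative A -> negative A -> Prop :=
| eq_Var (x : nat) : eq_neg (Var x) (Var x)
| eq_Sum (P Q : forall a : A, positive A) :
    (forall a, eq_pos (P a) (Q a)) -> eq_neg (Sum P) (Sum Q).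

Definition conj_index (A : signature) (P : positive A) : Type :=
  match P with Omega => Empty_set | Conj J _ => J end.

Definition conjunct (A : signature) (P : positive A)
    : conj_index P -> predesign A :=
  match P return conj_index P -> predesign A with
  | Omega => fun e => match e with end
  | Conj _ T => T
  end.

Definition conj_in (A : signature) (S : predesign A) (P : positive A) : Prop :=
  exists i : conj_index P, conjunct i = S.

Definition step (A : signature) (P Q : positive A) : Prop :=
  exists (R : forall a : A, positive A) (b : A)
         (N : 'I_(ar b) -> negative A),
    conj_in (Pre (Sum R) b N) P /\ Q = subst_pos (inst N) (R b).

Definition steps (A : signature) : positive A -> positive A -> Prop :=
  clos_refl_trans_1n (positive A) (@step A).

Definition diverges (A : signature) (P : positive A) : Prop :=
  (exists f : nat -> positive A, f 0 = P /\ forall n, step (f n) (f n.+1))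
  \/ steps P Omega.

Definition is_cut (A : signature) (S : predesign A) : bool :=
  if S is Pre (Sum _) _ _ then true else false.

Definition contract (A : signature) (S : predesign A) : positive A :=
  match S with
  | Pre (Sum R) b N => subst_pos (inst N) (R b)
  | Pre (Var _) _ _ => Omega
  end.

(* Finite reduction sequences from P, recorded by the conjuncts they contract.
   Unlike {Q | steps P Q}, this type lives in the universe of the index types
   of conjunctions, so that it can be used to index the normal form of P. *)
Inductive run (A : signature) (P : positive A) : Type :=
| Stop
| Fire (i : conj_index P) (_ : is_cut (conjunct i))
    (_ : run (contract (conjunct i))).

Arguments Stop {A P}.
Arguments Fire {A P} i _ _.

Fixpoint target (A : signature) (P : positive A) (r : run P) : positive A :=
  match r with
  | Stop => P
  | Fire _ _ r' => target r'
  end.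

(* The conjuncts [x | a<N>] of the reducts of P. *)
Definition head_occ (A : signature) (P : positive A) : Type :=
  { r : run P & { i : conj_index (target r) | ~~ is_cut (conjunct i) } }.

Definition head_predesign (A : signature) (P : positive A) (h : head_occ P)
    : predesign A :=
  conjunct (projT1 (projT2 h)).

CoFixpoint nf_pos (A : signature) (P : positive A) : positive A :=
  if pselect (diverges P) then Omega
  else Conj (head_occ P) (fun h =>
    match head_predesign h with
    | Pre N0 a N => Pre N0 a (fun k => nf_neg (N k))
    end)
with nf_neg (A : signature) (N : negative A) : negative A :=
  match N with
  | Var x => Var x
  | Sum P => Sum (fun a => nf_pos (P a))
  end.

Inductive design (A : signature) : Type :=
| DPos (P : positive A)
| DPre (S : predesign A)
| DNeg (N : negative A).

Arguments DPos {A} P.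
Arguments DPre {A} S.
Arguments DNeg {A} N.

Definition unary (A : signature) (S : predesign A) : positive A :=
  Conj unit (fun=> S).

Definition subst (A : signature) (s : nat -> negative A) (D : design A)
    : design A :=
  match D with
  | DPos P => DPos (subst_pos s P)
  | DPre T => DPre (subst_pre s T)
  | DNeg N => DNeg (subst_neg s N)
  end.

Definition nf (A : signature) (D : design A) : design A :=
  match D with
  | DPos P => DPos (nf_pos P)
  | DPre T => DPos (nf_pos (unary T))
  | DNeg N => DNeg (nf_neg N)
  end.

(* A predesign is identified with the corresponding unary conjunction. *)
Definition eq_design (A : signature) (D E : design A) : Prop :=
  match D, E with
  | DPos P, DPos Q => eq_pos P Q
  | DPos P, DPre T => eq_pos P (unary T)
  | DPre T, DPos Q => eq_pos (unary T) Q
  | DPre T, DPre U => eq_pre T U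
  | DNeg N, DNeg M => eq_neg N M
  | _, _ => False
  end.

Lemma nf_posE (A : signature) (P : positive A) :
  nf_pos P =
  if pselect (diverges P) then Omega
  else Conj (head_occ P) (fun h =>
    match head_predesign h with
    | Pre N0 a N => Pre N0 a (fun k => nf_neg (N k))
    end).
Proof.
have E (Q : positive A) :
  Q = match Q with Omega => Omega | Conj J T => Conj J T end by case: Q.
by rewrite [LHS]E /=; case: (pselect _).
Qed.

Lemma nf_pos_diverges (A : signature) (P : positive A) :
  diverges P -> nf_pos P = Omega.
Proof. by move=> dP; rewrite nf_posE; case: (pselect _). Qed.

Lemma nf_pos_converges (A : signature) (P : positive A) :
  ~ diverges P ->
  nf_pos P = Conj (head_occ P) (fun h =>
    match head_predesign h with
    | Pre N0 a N => Pre N0 a (fun k => nf_neg (N k))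
    end).
Proof. by move=> ndP; rewrite nf_posE; case: (pselect _). Qed.

Lemma steps_run (A : signature) (P Q : positive A) :
  steps P Q <-> exists r : run P, target r = Q.
Proof.
split=> [|[r <-]].
  elim=> [R|R R' R'' [B [b [N [[i iE] ->]]]] _ [r rE]]; first by exists Stop.
  have ci : is_cut (conjunct i) by rewrite iE.
  have [r' r'E] : exists r' : run (contract (conjunct i)), target r' = R''.
    by rewrite iE; exists r.
  by exists (Fire i ci r').
elim: r => [R|R i ci r IH] /=; first exact: rt1n_refl.
apply: (rt1n_trans _ _ _ _ _ _ IH).
case ES: (conjunct i) ci => [[x|B] b N] //= _.
by exists B, b, N; split=> //; exists i.
Qed.

(* The defining clause of the normal form of a convergent P, in terms of
   [steps]. *)
Lemma conj_in_nf_pos (A : signature) (P : positive A) (S : predesign A) :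
  ~ diverges P ->
  conj_in S (nf_pos P) <->
  exists (Q : positive A) (x : nat) (a : A) (N : 'I_(ar a) -> negative A),
    [/\ steps P Q, conj_in (Pre (Var x) a N) Q
      & S = Pre (Var x) a (fun k => nf_neg (N k))].
Proof.
move=> ndP; rewrite nf_pos_converges //; split.
  case=> -[r [i ni]] /=; rewrite /head_predesign /=.
  have [x [a [N Ei]]] : exists x a N, conjunct i = Pre (Var x) a N.
    by case: (conjunct i) ni => [[x|B] a N] //= _; exists x, a, N.
  rewrite Ei => <-.
  exists (target r), x, a, N; split=> //; last by exists i.
  by apply/steps_run; exists r.
case=> Q [x [a [N [/steps_run [r <-] [i Ei] ->]]]].
have ni : ~~ is_cut (conjunct i) by rewrite Ei.
exists (existT _ r (exist _ i ni) : head_occ P).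
by rewrite /head_predesign /= Ei.
Qed.

(* Main.v *)
(* Call two designs equivalent when their normal forms are equal; [nf] being
   idempotent, D is equivalent to [nf D], so the theorem says that this
   equivalence is a congruence for substitution.  Close it inductively under
   simultaneous substitution.  The closure is a bisimulation for normal forms:
   a reduction of P[s] follows a reduction of P until it fires a cut obtained
   by substituting a sum for the head variable of a conjunct of a reduct of P.
   If P is equivalent to P', then P' reaches a matching conjunct, and the two
   contracted cuts are again related by the closure.  Since at least one step
   has been spent, induction on the convergence of P[s] shows that P'[s']
   converges, and induction on the length of the reduction matches the
   conjuncts of the normal forms. *)

Require Import Defs.
From mathcomp Require Import all_boot.
From mathcomp Require Import boolp.
From Stdlib Require Import Relation_Operators.

Set Implicit Arguments.
Unset Strict Implicit.
Unset Printing Implicit Defensive.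

(** * Coinduction and equivalence properties for equality of designs *)

Section Equality.
Context {A : signature}.
Implicit Types (P Q : positive A) (S T : predesign A) (N M : negative A).

(** The arity depends on the name, so the two argument families have different types until an
    equality [e] of names transports the index. *)
Definition pre_rel (RN : negative A -> negative A -> Prop) S T : Prop :=
  match S, T with
  | Pre N0 a N, Pre M0 b M =>
    RN N0 M0 /\
    exists e : a = b, forall k,
      RN (N k) (M (eq_rect a (fun c => 'I_(ar c)) k b e))
  end.

Definition pos_rel (RN : negative A -> negative A -> Prop) P Q : Prop :=
  match P, Q with
  | Omega, Omega => True
  | Conj _ F, Conj _ G =>
    (forall i, exists j, pre_rel RN (F i) (G j)) /\
    (forall j, exists i, pre_rel RN (F i) (G j))
  | _, _ => False
  end.

Definition neg_rel (RP : positive A -> positive A -> Prop) N M : Prop :=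
  match N, M with
  | Var x, Var y => x = y
  | Sum P, Sum Q => forall a, RP (P a) (Q a)
  | _, _ => False
  end.

(** The guarded corecursion is done once here; later bisimulations only check one layer. The
    disjunct [eq_neg N M] lets a proof stop where equality is already known, as when a traversal
    replaces a variable by a whole design. *)
Lemma eq_coind (RP : positive A -> positive A -> Prop)
    (RN : negative A -> negative A -> Prop) :
  (forall P Q, RP P Q -> pos_rel RN P Q) ->
  (forall N M, RN N M -> eq_neg N M \/ neg_rel RP N M) ->
  (forall P Q, RP P Q -> eq_pos P Q) /\ (forall N M, RN N M -> eq_neg N M).
Proof.
move=> HP HN.
have F : forall P Q, RP P Q -> eq_pos P Q.
  cofix Fp with (Fs S T (_ : pre_rel RN S T) : eq_pre S T)
                (Fn N M (_ : RN N M) : eq_neg N M).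
  - move=> P Q /HP; case: P Q => [|I F] [|J G] //=.
      by move=> _; apply: eq_Omega.
    case=> h1 h2; apply: eq_Conj => [i|j].
      by case: (h1 i) => j h; exists j; apply: Fs.
    by case: (h2 j) => i h; exists i; apply: Fs.
  - move=> S T; case: S T => N0 a N [M0 b M] /= [h0 [e]].
    case: _ / e M => M /= h.
    by apply: eq_Pre => [|k]; apply: Fn.
  - move=> N M /HN [] //; case: N M => [x|P] [y|Q] //= => [->|h].
      exact: eq_Var.
    by apply: eq_Sum => a; apply: Fp.
split=> // N M /HN [] //; case: N M => [x|P] [y|Q] //= => [->|h].
  exact: eq_Var.
by apply: eq_Sum => a; apply: F.
Qed.

Lemma eq_preE S T : eq_pre S T <-> pre_rel (@eq_neg A) S T.
Proof.
split; first by case=> N0 M0 a N M h0 h /=; split=> //; exists erefl.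
case: S T => N0 a N [M0 b M] /= [h0 [e]].
by case: _ / e M => M /= h; apply: eq_Pre.
Qed.

Lemma eq_posE P Q : eq_pos P Q <-> pos_rel (@eq_neg A) P Q.
Proof.
split.
  case=> //= I J S T h1 h2; split=> [i|j].
    by case: (h1 i) => j /eq_preE h; exists j.
  by case: (h2 j) => i /eq_preE h; exists i.
case: P Q => [|I S] [|J T] //=; first by move=> _; apply: eq_Omega.
case=> h1 h2; apply: eq_Conj => [i|j].
  by case: (h1 i) => j /eq_preE h; exists j.
by case: (h2 j) => i /eq_preE h; exists i.
Qed.

Lemma eq_negE N M : eq_neg N M <-> neg_rel (@eq_pos A) N M.
Proof.
split; first by case.
case: N M => [x|P] [y|Q] //= => [->|h]; first exact: eq_Var.
exact: eq_Sum.
Qed.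

Lemma pre_rel_mono (R1 R2 : negative A -> negative A -> Prop) S T :
  (forall N M, R1 N M -> R2 N M) -> pre_rel R1 S T -> pre_rel R2 S T.
Proof.
move=> H; case: S T => N0 a N [M0 b M] /= [h0 [e h]].
by split; [apply: H | exists e => k; apply: H].
Qed.

Lemma pre_rel_sym (R : negative A -> negative A -> Prop) S T :
  pre_rel R S T -> pre_rel (fun N M => R M N) T S.
Proof.
case: S T => N0 a N [M0 b M] /= [h0 [e]].
by case: _ / e M => M /= h; split=> //; exists erefl.
Qed.

Lemma pre_rel_comp (R1 R2 : negative A -> negative A -> Prop) S T U :
  pre_rel R1 S T -> pre_rel R2 T U ->
  pre_rel (fun N M => exists2 K, R1 N K & R2 K M) S U.
Proof.
case: S T U => N0 a N [M0 b M] [K0 c K] /= [h0 [e]].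
case: _ / e M => M /= h [g0 [f]]; case: _ / f K => K /= g.
by split; [exists M0 | exists erefl => k; exists (M k)].
Qed.

Lemma pre_rel_refl (R : negative A -> negative A -> Prop) S :
  (forall N, R N N) -> pre_rel R S S.
Proof. by case: S => N0 a N H /=; split=> //; exists erefl. Qed.

Lemma eq_refl_both : (forall P, eq_pos P P) /\ (forall N, eq_neg N N).
Proof.
have [hP hN] : (forall P Q, P = Q -> eq_pos P Q) /\
               (forall N M, N = M -> eq_neg N M).
  apply: eq_coind => [P _ <-|N _ <-].
    case: P => //= I F.
    by split=> i; exists i; apply: pre_rel_refl.
  by right; case: N.
by split=> [P|N]; [apply: hP | apply: hN].
Qed.

Lemma eq_pos_refl P : eq_pos P P. Proof. exact: (proj1 eq_refl_both). Qed.
Lemma eq_neg_refl N : eq_neg N N. Proof. exact: (proj2 eq_refl_both). Qed.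

Lemma eq_sym_both :
  (forall P Q, eq_pos Q P -> eq_pos P Q) /\
  (forall N M, eq_neg M N -> eq_neg N M).
Proof.
apply: eq_coind => [P Q|N M].
  move/eq_posE; case: P Q => [|I S] [|J T] //= [h1 h2].
  split=> [i|j].
    by have [j /pre_rel_sym h] := h2 i; exists j.
  by have [i /pre_rel_sym h] := h1 j; exists i.
move/eq_negE; case: N M => [x|P] [y|Q] //= h; first 
  by left; rewrite h; apply: eq_Var.
by right.
Qed.

Lemma eq_pos_sym P Q : eq_pos Q P -> eq_pos P Q.
Proof. exact: (proj1 eq_sym_both). Qed.
Lemma eq_neg_sym N M : eq_neg M N -> eq_neg N M.
Proof. exact: (proj2 eq_sym_both). Qed.

Lemma eq_trans_both :
  (forall P Q, (exists2 R, eq_pos P R & eq_pos R Q) -> eq_pos P Q) /\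
  (forall N M, (exists2 K, eq_neg N K & eq_neg K M) -> eq_neg N M).
Proof.
apply: eq_coind => [P Q [R]|N M [K]].
  move=> /eq_posE + /eq_posE; case: P R Q => [|I S] [|J T] [|K U] //=.
  case=> h1 h2 [g1 g2]; split=> [i|k].
    by have [j hj] := h1 i; have [k hk] := g1 j; exists k;
      apply: pre_rel_comp hj hk.
  by have [j hj] := g2 k; have [i hi] := h2 j; exists i;
    apply: pre_rel_comp hi hj.
move=> /eq_negE + /eq_negE; case: N K M => [x|P] [y|Q] [z|R] //=.
  by move=> -> ->; left; apply: eq_Var.
by move=> h1 h2; right=> a; exists (Q a).
Qed.

Lemma eq_pos_trans P Q R : eq_pos P Q -> eq_pos Q R -> eq_pos P R.
Proof. by move=> h1 h2; apply: (proj1 eq_trans_both); exists Q. Qed.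
Lemma eq_neg_trans N M K : eq_neg N M -> eq_neg M K -> eq_neg N K.
Proof. by move=> h1 h2; apply: (proj2 eq_trans_both); exists M. Qed.

End Equality.

(** * Composition laws for renaming and substitution *)

Section Substitution.
Context {A : signature}.
Implicit Types (P Q : positive A) (S T : predesign A) (N M : negative A)
  (s t u : nat -> negative A) (r : nat -> nat).

Definition pre_map (f : negative A -> negative A) S : predesign A :=
  match S with Pre N0 a N => Pre (f N0) a (fun k => f (N k)) end.

Definition pos_map (f : negative A -> negative A) P : positive A :=
  match P with
  | Omega => Omega
  | Conj J F => Conj J (fun i => pre_map f (F i))
  end.

Lemma pos_rel_map (R1 R2 : negative A -> negative A -> Prop) f g P Q :
  (forall N M, R1 N M -> R2 (f N) (g M)) ->
  pos_rel R1 P Q -> pos_rel R2 (pos_map f P) (pos_map g Q).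
Proof.
move=> H; have aux S T : pre_rel R1 S T -> pre_rel R2 (pre_map f S) (pre_map g T).
  case: S T => N0 a N [M0 b M] /= [h0 [e h]].
  by split; [apply: H | exists e => k; apply: H].
case: P Q => [|I F] [|J G] //= [h1 h2]; split=> [i|j].
  by have [j h] := h1 i; exists j; apply: aux.
by have [i h] := h2 j; exists i; apply: aux.
Qed.

Lemma pos_map_comp f g P : pos_map g (pos_map f P) = pos_map (g \o f) P.
Proof.
case: P => //= I F; congr Conj; apply: funext => i.
by case: (F i).
Qed.

Lemma pos_map_id P : pos_map id P = P.
Proof. by case: P => //= I F; congr Conj; apply: funext => i; case: (F i). Qed.

(** A cofixpoint unfolds only under a match; rewriting with this identity, or with its two analogues
    below, forces one unfolding. *)
Lemma negE N : N = match N with Var x => Var x | Sum P => Sum P end.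
Proof. by case: N. Qed.

Lemma preE S : S = match S with Pre N0 a N => Pre N0 a N end.
Proof. by case: S. Qed.

Lemma posE P : P = match P with Omega => Omega | Conj J F => Conj J F end.
Proof. by case: P. Qed.

Lemma subst_Var s x : subst_neg s (Var x) = s x.
Proof. by rewrite [LHS]negE /=; case: (s x). Qed.

Lemma subst_Sum s (P : forall a : A, positive A) :
  subst_neg s (Sum P) = Sum (fun a => subst_pos (up_subst (ar a) s) (P a)).
Proof. by rewrite [LHS]negE. Qed.

Lemma subst_preE s S : subst_pre s S = pre_map (subst_neg s) S.
Proof. by rewrite [LHS]preE; case: S. Qed.

Lemma subst_posE s P : subst_pos s P = pos_map (subst_neg s) P.
Proof.
rewrite [LHS]posE; case: P => //= I F; congr Conj; apply: funext => i.
exact: subst_preE.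
Qed.

Lemma ren_Var r x : ren_neg r (Var x) = Var (r x) :> negative A.
Proof. by rewrite [LHS]negE. Qed.

Lemma ren_Sum r (P : forall a : A, positive A) :
  ren_neg r (Sum P) = Sum (fun a => ren_pos (up_ren (ar a) r) (P a)).
Proof. by rewrite [LHS]negE. Qed.

Lemma ren_posE r P : ren_pos r P = pos_map (ren_neg r) P.
Proof.
rewrite [LHS]posE; case: P => //= I F; congr Conj; apply: funext => i.
by rewrite [LHS]preE; case: (F i).
Qed.

(* Two traversals of a design that agree on variables agree everywhere: [X]
   is the type of the environments carried along, [up] their passage under a
   binder and [C] the invariant relating the two traversals. *)
Lemma traversal_eq (X : Type) (C : X -> Prop) (up : nat -> X -> X)
    (fp gp : X -> positive A -> positive A)
    (f g : X -> negative A -> negative A) :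
  (forall x P, fp x P = pos_map (f x) P) ->
  (forall x P, gp x P = pos_map (g x) P) ->
  (forall x R, f x (Sum R) = Sum (fun a => fp (up (ar a) x) (R a))) ->
  (forall x R, g x (Sum R) = Sum (fun a => gp (up (ar a) x) (R a))) ->
  (forall k x, C x -> C (up k x)) ->
  (forall x v, C x -> eq_neg (f x (Var v)) (g x (Var v))) ->
  forall x, C x ->
    (forall P Q, eq_pos P Q -> eq_pos (fp x P) (gp x Q)) /\
    (forall N M, eq_neg N M -> eq_neg (f x N) (g x M)).
Proof.
move=> fE gE fS gS Cup CV.
pose RP P' Q' := exists x P Q,
  [/\ C x, eq_pos P Q, P' = fp x P & Q' = gp x Q].
pose RN N' M' := exists x N M,
  [/\ C x, eq_neg N M, N' = f x N & M' = g x M].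
have [hP hN] : (forall P Q, RP P Q -> eq_pos P Q) /\
               (forall N M, RN N M -> eq_neg N M).
  apply: eq_coind => [_ _ [x [P [Q [Cx /eq_posE + -> ->]]]]
                     |_ _ [x [N [M [Cx /eq_negE + -> ->]]]]].
    rewrite fE gE; apply: pos_rel_map => N M e.
    by exists x, N, M.
  case: N M => [v|P] [w|Q] //= => [<-|h]; first by left; apply: CV.
  right; rewrite fS gS => a; exists (up (ar a) x), (P a), (Q a).
  by split=> //; apply: Cup.
move=> x Cx; split=> [P Q e|N M e].
  by apply: hP; exists x, P, Q.
by apply: hN; exists x, N, M.
Qed.

Lemma up_ren_comp k r1 r2 r3 :
  (forall x, r3 x = r2 (r1 x)) ->
  forall x, up_ren k r3 x = up_ren k r2 (up_ren k r1 x).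
Proof.
move=> E x; rewrite /up_ren; case: ifP => [->//|hx].
by rewrite ltnNge leq_addr /= addKn E.
Qed.

(** For this and the following composition laws, the environment of [traversal_eq] bundles both maps
    with their composite, and the invariant is the pointwise composition equation. The order
    matters: the binder case of [ren_subst] uses [ren_ren], and that of [subst_subst_both] uses
    [subst_ren] and [ren_subst]. *)
Lemma ren_ren r1 r2 r3 : (forall x, r3 x = r2 (r1 x)) ->
  forall N M, eq_neg N M -> eq_neg (ren_neg r2 (ren_neg r1 N)) (ren_neg r3 M).
Proof.
move=> E; apply: (proj2 (@traversal_eq
  ((nat -> nat) * (nat -> nat) * (nat -> nat))%type
  (fun x => forall v, x.2 v = x.1.2 (x.1.1 v))
  (fun k x => (up_ren k x.1.1, up_ren k x.1.2, up_ren k x.2))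
  (fun x P => ren_pos x.1.2 (ren_pos x.1.1 P)) (fun x => ren_pos x.2)
  (fun x N => ren_neg x.1.2 (ren_neg x.1.1 N)) (fun x => ren_neg x.2)
  _ _ _ _ _ _ (r1, r2, r3) E)) => [x P|x P|x P|x P|k x Cx|x v Cx] /=.
- by rewrite !ren_posE pos_map_comp.
- exact: ren_posE.
- by rewrite !ren_Sum.
- exact: ren_Sum.
- exact: up_ren_comp.
- by rewrite !ren_Var Cx; apply: eq_Var.
Qed.

Lemma ren_eq r N M : eq_neg N M -> eq_neg (ren_neg r N) (ren_neg r M).
Proof.
apply: (proj2 (@traversal_eq (nat -> nat) (fun=> True) up_ren
  (@ren_pos A) (@ren_pos A) (@ren_neg A) (@ren_neg A)
  _ _ _ _ _ _ r I)) => // [x P|x P|x P|x P|x v _].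
- exact: ren_posE.
- exact: ren_posE.
- exact: ren_Sum.
- exact: ren_Sum.
- exact: eq_neg_refl.
Qed.

Lemma subst_ren r s t : (forall x, t x = s (r x)) ->
  forall N M, eq_neg N M -> eq_neg (subst_neg s (ren_neg r N)) (subst_neg t M).
Proof.
move=> E; apply: (proj2 (@traversal_eq
  ((nat -> nat) * (nat -> negative A) * (nat -> negative A))%type
  (fun x => forall v, x.2 v = x.1.2 (x.1.1 v))
  (fun k x => (up_ren k x.1.1, up_subst k x.1.2, up_subst k x.2))
  (fun x P => subst_pos x.1.2 (ren_pos x.1.1 P)) (fun x => subst_pos x.2)
  (fun x N => subst_neg x.1.2 (ren_neg x.1.1 N)) (fun x => subst_neg x.2)
  _ _ _ _ _ _ (r, s, t) E)) => [x P|x P|x P|x P|k x Cx|x v Cx] /=.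
- by rewrite subst_posE ren_posE pos_map_comp.
- exact: subst_posE.
- by rewrite ren_Sum subst_Sum.
- exact: subst_Sum.
- move=> v; rewrite /up_subst /up_ren; case: ifP => [->//|hv].
  by rewrite ltnNge leq_addr /= addKn Cx.
- by rewrite ren_Var !subst_Var Cx; apply: eq_neg_refl.
Qed.

Lemma ren_subst r s t : (forall x, eq_neg (ren_neg r (s x)) (t x)) ->
  forall N M, eq_neg N M -> eq_neg (ren_neg r (subst_neg s N)) (subst_neg t M).
Proof.
move=> E; apply: (proj2 (@traversal_eq
  ((nat -> nat) * (nat -> negative A) * (nat -> negative A))%type
  (fun x => forall v, eq_neg (ren_neg x.1.1 (x.1.2 v)) (x.2 v))
  (fun k x => (up_ren k x.1.1, up_subst k x.1.2, up_subst k x.2))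
  (fun x P => ren_pos x.1.1 (subst_pos x.1.2 P)) (fun x => subst_pos x.2)
  (fun x N => ren_neg x.1.1 (subst_neg x.1.2 N)) (fun x => subst_neg x.2)
  _ _ _ _ _ _ (r, s, t) E)) => [x P|x P|x P|x P|k x Cx|x v Cx] /=.
- by rewrite subst_posE ren_posE pos_map_comp.
- exact: subst_posE.
- by rewrite subst_Sum ren_Sum.
- exact: subst_Sum.
- move=> v; rewrite /up_subst; case: ifP => hv.
    by rewrite ren_Var /up_ren hv; apply: eq_Var.
  apply: eq_neg_trans (ren_eq (addn k) (Cx (v - k))).
  (* Lifting then shifting and shifting after renaming both amount to the single renaming that sends
     [z] to [k + x.1.1 z]. *)
  apply: (@eq_neg_trans _ _ (ren_neg (fun z => k + x.1.1 z) (x.1.2 (v - k)))).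
    apply: ren_ren (eq_neg_refl _) => z.
    by rewrite /up_ren ltnNge leq_addr /= addKn.
  by apply/eq_neg_sym/ren_ren/eq_neg_refl.
- by rewrite !subst_Var.
Qed.

Lemma subst_subst_both s t u :
  (forall x, eq_neg (subst_neg s (t x)) (u x)) ->
  (forall P Q, eq_pos P Q ->
     eq_pos (subst_pos s (subst_pos t P)) (subst_pos u Q)) /\
  (forall N M, eq_neg N M ->
     eq_neg (subst_neg s (subst_neg t N)) (subst_neg u M)).
Proof.
move=> E; apply: (@traversal_eq
  ((nat -> negative A) * (nat -> negative A) * (nat -> negative A))%type
  (fun x => forall v, eq_neg (subst_neg x.1.1 (x.1.2 v)) (x.2 v))
  (fun k x => (up_subst k x.1.1, up_subst k x.1.2, up_subst k x.2))
  (fun x P => subst_pos x.1.1 (subst_pos x.1.2 P)) (fun x => subst_pos x.2)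
  (fun x N => subst_neg x.1.1 (subst_neg x.1.2 N)) (fun x => subst_neg x.2)
  _ _ _ _ _ _ (s, t, u) E) => [x P|x P|x P|x P|k x Cx|x v Cx] /=.
- by rewrite !subst_posE pos_map_comp.
- exact: subst_posE.
- by rewrite !subst_Sum.
- exact: subst_Sum.
- move=> v; rewrite /up_subst; case: ifP => hv.
    by rewrite subst_Var hv; apply: eq_Var.
  apply: eq_neg_trans (ren_eq (addn k) (Cx (v - k))).
  (* A lifted substitution applied to a shifted design is the unlifted substitution with shifted
     values. *)
  apply: (@eq_neg_trans _ _
    (subst_neg (fun z => ren_neg (addn k) (x.1.1 z)) (x.1.2 (v - k)))).
    apply: subst_ren (eq_neg_refl _) => z.
    by rewrite ltnNge leq_addr /= addKn.
  apply/eq_neg_sym/ren_subst/eq_neg_refl => z.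
  exact: eq_neg_refl.
- by rewrite !subst_Var.
Qed.

Lemma subst_pos_comp s t P :
  eq_pos (subst_pos s (subst_pos t P)) (subst_pos (fun x => subst_neg s (t x)) P).
Proof.
by apply: (proj1 (subst_subst_both _)) => [x|];
  [apply: eq_neg_refl | apply: eq_pos_refl].
Qed.

Lemma subst_neg_comp s t N :
  eq_neg (subst_neg s (subst_neg t N)) (subst_neg (fun x => subst_neg s (t x)) N).
Proof.
by apply: (proj2 (subst_subst_both _)) => [x|]; apply: eq_neg_refl.
Qed.

Lemma subst_eq_both s t : (forall x, eq_neg (s x) (t x)) ->
  (forall P Q, eq_pos P Q -> eq_pos (subst_pos s P) (subst_pos t Q)) /\
  (forall N M, eq_neg N M -> eq_neg (subst_neg s N) (subst_neg t M)).
Proof.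
move=> E; apply: (@traversal_eq
  ((nat -> negative A) * (nat -> negative A))%type
  (fun x => forall v, eq_neg (x.1 v) (x.2 v))
  (fun k x => (up_subst k x.1, up_subst k x.2))
  (fun x => subst_pos x.1) (fun x => subst_pos x.2)
  (fun x => subst_neg x.1) (fun x => subst_neg x.2)
  _ _ _ _ _ _ (s, t) E) => [x P|x P|x P|x P|k x Cx|x v Cx] /=.
- exact: subst_posE.
- exact: subst_posE.
- exact: subst_Sum.
- exact: subst_Sum.
- move=> v; rewrite /up_subst; case: ifP => _; first exact: eq_Var.
  exact: ren_eq.
- by rewrite !subst_Var.
Qed.

Definition subst_pos_eq s t P Q (E : forall x, eq_neg (s x) (t x)) (e : eq_pos P Q)
  : eq_pos (subst_pos s P) (subst_pos t Q) := proj1 (subst_eq_both E) P Q e.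

Definition subst_neg_eq s t N M (E : forall x, eq_neg (s x) (t x)) (e : eq_neg N M)
  : eq_neg (subst_neg s N) (subst_neg t M) := proj2 (subst_eq_both E) N M e.

(** The invariant admits any [s] agreeing pointwise with [Var], because a binder turns [Var] into
    [up_subst k Var]. *)
Lemma subst_id_both :
  (forall P Q, eq_pos P Q -> eq_pos (subst_pos Var P) Q) /\
  (forall N M, eq_neg N M -> eq_neg (subst_neg Var N) M).
Proof.
apply: (@traversal_eq (nat -> negative A) (fun s => forall x, s x = Var x)
  (@up_subst A) (@subst_pos A) (fun=> id) (@subst_neg A) (fun=> id)
  _ _ _ _ _ _ Var) => // [s P|s P|s P|k s E|s v E].
- exact: subst_posE.
- by rewrite pos_map_id.
- exact: subst_Sum.
- move=> x; rewrite /up_subst; case: ltnP => // kx.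
  by rewrite E ren_Var subnKC.
- by rewrite subst_Var E; apply: eq_Var.
Qed.

Lemma subst_neg_id N : eq_neg (subst_neg Var N) N.
Proof. exact: (proj2 subst_id_both _ _ (eq_neg_refl N)). Qed.

Lemma ren_as_subst r N : eq_neg (ren_neg r N) (subst_neg (fun x => Var (r x)) N).
Proof.
apply: (@eq_neg_trans _ _ (subst_neg Var (ren_neg r N))).
  exact/eq_neg_sym/subst_neg_id.
by apply: subst_ren (eq_neg_refl N).
Qed.

(** Substitution commutes with the contraction of a cut; this is what carries reductions of a design
    over to its substitution instances. *)
Lemma subst_inst s k (N : 'I_k -> negative A) P :
  eq_pos (subst_pos (inst (fun i => subst_neg s (N i)))
                    (subst_pos (up_subst k s) P))
         (subst_pos s (subst_pos (inst N) P)).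
Proof.
apply: eq_pos_trans (eq_pos_sym (subst_pos_comp _ _ _)).
apply: (proj1 (subst_subst_both _)) (eq_pos_refl P) => x.
(* An index below [k] selects an argument on both sides; above [k], the shift by [k] made by lifting
   is cancelled by the instantiation. *)
rewrite /up_subst /inst; case: insubP => [i -> <-|/negbTE ->].
  rewrite subst_Var; case: insubP => [j _ /val_inj ->|]; first exact: eq_neg_refl.
  by rewrite ltn_ord.
rewrite subst_Var.
apply: eq_neg_trans (subst_neg_id _).
apply: subst_ren (eq_neg_refl _) => z.
by rewrite insubF ?ltnNge ?leq_addr //= addKn.
Qed.

End Substitution.

(** * Reduction up to equality, convergence and heads *)

Section Reduction.
Context {A : signature}.
Implicit Types (P Q : positive A) (S T : predesign A) (N M : negative A)
  (s t u : nat -> negative A).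

Lemma conj_in_Omega S : ~ conj_in S Omega.
Proof. by case=> []. Qed.

(** An index-free form, so that conjuncts can be matched as elements of sets. *)
Lemma pos_relP (R : negative A -> negative A -> Prop) P Q :
  pos_rel R P Q <->
  [/\ P = Omega <-> Q = Omega,
      forall S, conj_in S P -> exists2 T, conj_in T Q & pre_rel R S T
    & forall T, conj_in T Q -> exists2 S, conj_in S P & pre_rel R S T].
Proof.
split.
  case: P Q => [|I F] [|J G] //=.
    by move=> _; split=> // S /conj_in_Omega.
  case=> h1 h2; split=> // [S [i /= <-]|T [j /= <-]].
    by have [j h] := h1 i; exists (G j) => //; exists j.
  by have [i h] := h2 j; exists (F i) => //; exists i.
case: P Q => [|I F] [|J G] //= [e h1 h2].
- by have := e.1 erefl.
- by have := e.2 erefl.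
split=> [i|j].
  by have [|_ [j /= <-] h] := h1 (F i); [exists i | exists j].
by have [|_ [i /= <-] h] := h2 (G j); [exists j | exists i].
Qed.

Lemma conj_in_map f S P :
  conj_in S (pos_map f P) <-> exists2 T, conj_in T P & S = pre_map f T.
Proof.
case: P => [|I F] /=.
  by split=> [/conj_in_Omega|[T /conj_in_Omega]].
split; first by case=> i /= <-; exists (F i) => //; exists i.
by case=> _ [i /= <-] ->; exists i.
Qed.

Lemma pos_map_Omega f P : pos_map f P = Omega <-> P = Omega.
Proof. by case: P. Qed.

Lemma pre_rel_map (R : negative A -> negative A -> Prop) f g S T :
  pre_rel R (pre_map f S) (pre_map g T) <->
  pre_rel (fun N M => R (f N) (g M)) S T.
Proof. by case: S T => N0 a N [M0 b M]. Qed.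

Lemma stepE P Q :
  step P Q <-> exists S, [/\ conj_in S P, is_cut S & Q = contract S].
Proof.
split; first by case=> R [b [N [h ->]]]; exists (Pre (Sum R) b N).
by case=> -[[x|R] b N] [h c ->] //; exists R, b, N.
Qed.

Lemma steps_rcons P Q R : steps P Q -> step Q R -> steps P R.
Proof.
elim=> [P' h|P' Q' R' h _ IH /IH]; last exact: rt1n_trans.
exact: rt1n_trans h (rt1n_refl _ _ _).
Qed.

Lemma steps_step P Q R :
  steps P Q -> step Q R -> exists2 P', step P P' & steps P' R.
Proof.
case=> [h|P1 Q1 h hs hr]; first by exists R => //; apply: rt1n_refl.
by exists P1 => //; apply: steps_rcons hr.
Qed.

Lemma eq_contract S T : pre_rel (@eq_neg A) S T ->
  is_cut S = is_cut T /\ eq_pos (contract S) (contract T).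
Proof.
case: S T => N0 a N [M0 b M] /= [/eq_negE + [e]].
case: _ / e M => M; case: N0 M0 => [x|P] [y|Q] //= h hk; split=> //.
  (* Two head variables: [contract] returns its default [Omega] on both sides. *)
  exact: eq_Omega.
apply: subst_pos_eq => // x; rewrite /inst.
by case: insubP => // _; apply: eq_Var.
Qed.

Lemma step_eq P P' Q : eq_pos P P' -> step P Q ->
  exists2 Q', step P' Q' & eq_pos Q Q'.
Proof.
move=> /eq_posE/pos_relP[_ h _] /stepE[S [/h[T hT /eq_contract[e1 e2]] cS ->]].
by exists (contract T) => //; apply/stepE; exists T; rewrite -e1.
Qed.

Lemma steps_eq P P' Q : eq_pos P P' -> steps P Q ->
  exists2 Q', steps P' Q' & eq_pos Q Q'.
Proof.
move=> + h; elim: h P' => [P1 P' e|P1 Q1 R1 h _ IH P' /step_eq/(_ h)[Q' h' /IH]].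
  by exists P' => //; apply: rt1n_refl.
by case=> R' hs e; exists R' => //; apply: rt1n_trans h' hs.
Qed.

(** Convergence as accessibility for [step] with [Omega] excluded; unlike the negation of
    [diverges], it comes with an induction principle. *)
Inductive conv P : Prop :=
| Conv : P <> Omega -> (forall Q, step P Q -> conv Q) -> conv P.

Lemma conv_neq P : conv P -> P <> Omega. Proof. by case. Qed.

Lemma conv_step P Q : conv P -> step P Q -> conv Q.
Proof. by case=> _; apply. Qed.

Lemma conv_steps P Q : conv P -> steps P Q -> conv Q.
Proof.
move=> + h; elim: h => [//|P1 Q1 R1 h _ IH c].
exact: IH (conv_step c h).
Qed.

Lemma conv_eq P P' : eq_pos P P' -> conv P -> conv P'.
Proof.
move=> + c; elim: c P' => {}P nO _ IH P' e; apply: Conv => [E|Q' h].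
  by move/eq_posE/pos_relP: e => [[_ e] _ _]; apply/nO/e.
by have [Q hQ /eq_pos_sym] := step_eq (eq_pos_sym e) h; apply: IH.
Qed.

Lemma divergesP P : diverges P <-> ~ conv P.
Proof.
split.
  case=> [[f [<- h]]|h c]; last exact: conv_neq (conv_steps c h) erefl.
  (* By induction on convergence, no member of an infinite reduction sequence converges. *)
  have no Q : conv Q -> forall n, f n <> Q.
    elim=> {}Q _ _ IH n E; apply: (IH (f n.+1) _ n.+1 erefl).
    by rewrite -E; apply: h.
  by move=> c; apply: (no _ c 0).
move=> nc; have [h|nO] := pselect (steps P Omega); [by right | left].
(* The hypotheses on [Q] sit under the existential so that [choice] yields a total function, whose
   iterates from [P] form the infinite sequence. *)
have next Q : exists Q', ~ conv Q -> Q <> Omega -> step Q Q' /\ ~ conv Q'.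
  have [[Q' h]|h] := pselect (exists Q', step Q Q' /\ ~ conv Q').
    by exists Q'.
  exists Q => ncQ nQ; case: ncQ; apply: Conv => [//|Q' st].
  by apply: contrapT => nc'; apply: h; exists Q'.
have [g gP] := choice next.
have inv n : steps P (iter n g P) /\ ~ conv (iter n g P).
  elim: n => [|n [IH1 IH2]] /=; first by split=> //; apply: rt1n_refl.
  have [|h1 h2] := gP _ IH2; first by move=> E; rewrite E in IH1.
  by split=> //; apply: steps_rcons h1.
exists (fun n => iter n g P); split=> // n /=.
have [h1 h2] := inv n.
by apply: (gP _ h2 _).1 => E; rewrite E in h1.
Qed.

(** The propositional counterpart of [head_occ]: the conjuncts that the normal form keeps, before
    their arguments are normalised. *)
Definition head P S : Prop :=
  exists Q, [/\ steps P Q, conj_in S Q & ~~ is_cut S].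

Lemma head_steps P Q S : steps P Q -> head Q S -> head P S.
Proof.
elim=> // P1 Q1 R1 h _ IH /IH [Q' [hs hc ?]].
by exists Q'; split=> //; apply: rt1n_trans hs.
Qed.

Lemma head_eq P P' S : eq_pos P P' -> head P S ->
  exists2 S', head P' S' & pre_rel (@eq_neg A) S S'.
Proof.
move=> e [Q [/(steps_eq e) [Q' hs' /eq_posE/pos_relP[_ h _]] /h [T hT eT] nc]].
by exists T => //; exists Q'; split=> //; rewrite -(eq_contract eT).1.
Qed.

End Reduction.

(** * One-layer description and idempotence of normal forms *)

Section NormalForm.
Context {A : signature}.
Implicit Types (P Q : positive A) (S T : predesign A) (N M : negative A).

Lemma nf_neg_Sum (P : forall a : A, positive A) :
  nf_neg (Sum P) = Sum (fun a => nf_pos (P a)).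
Proof. by rewrite [LHS]negE. Qed.

Lemma nf_neg_Var x : nf_neg (Var x) = Var x :> negative A.
Proof. by rewrite [LHS]negE. Qed.

Lemma conj_in_nf P S : conv P ->
  conj_in S (nf_pos P) <-> exists2 T, head P T & S = pre_map (@nf_neg A) T.
Proof.
move=> c; have nd : ~ diverges P by move/divergesP.
rewrite conj_in_nf_pos //; split.
  case=> Q [x [a [N [h1 h2 ->]]]]; exists (Pre (Var x) a N) => /=;
    last by rewrite nf_neg_Var.
  by exists Q.
case=> -[[x|R] a N] [Q [h1 h2 //= _]] ->.
by exists Q, x, a, N; rewrite nf_neg_Var.
Qed.

Lemma nf_pos_Omega P : nf_pos P = Omega <-> ~ conv P.
Proof.
rewrite -divergesP; split; last exact: nf_pos_diverges.
by move=> E; apply: contrapT => /nf_pos_converges; rewrite E.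
Qed.

(** This is the interface for coinduction on normal forms: one layer of a bisimulation amounts to
    agreement on convergence and a matching of heads in both directions. *)
Lemma nf_pos_rel (R : negative A -> negative A -> Prop) P P' :
  pos_rel R (nf_pos P) (nf_pos P') <->
  (conv P <-> conv P') /\
  (conv P ->
    (forall S, head P S -> exists2 S', head P' S' &
      pre_rel (fun N M => R (nf_neg N) (nf_neg M)) S S') /\
    (forall S', head P' S' -> exists2 S, head P S &
      pre_rel (fun N M => R (nf_neg N) (nf_neg M)) S S')).
Proof.
rewrite (propext (pos_relP _ _ _)).
rewrite (propext (nf_pos_Omega P)) (propext (nf_pos_Omega P')).
split.
  case=> e h1 h2.
  (* [e] compares the two divergences; the comparison of convergences follows classically. *)
  have {}e : conv P <-> conv P'.
    by split=> c; apply: contrapT => n; [move/e: n | move/e: n]; apply.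
  split=> // c; have c' := e.1 c; split=> S hS.
    have [|T hT r] := h1 (pre_map (@nf_neg A) S).
    by apply/conj_in_nf => //; exists S.
    move: hT r => /(conj_in_nf _ c')[S' hS' ->] /pre_rel_map r.
    by exists S'.
  have [|T hT r] := h2 (pre_map (@nf_neg A) S).
    by apply/conj_in_nf => //; exists S.
  move: hT r => /(conj_in_nf _ c)[S' hS' ->] /pre_rel_map r.
  by exists S'.
case=> e h; split; first by split=> n c; apply: n; apply/e.
- move=> S; have [c|/nf_pos_Omega ->] := pselect (conv P);
    last by move/conj_in_Omega.
  move=> /(conj_in_nf _ c)[T /((h c).1 _)[T' hT' r] ->].
  exists (pre_map (@nf_neg A) T'); last exact/pre_rel_map.
  by apply/conj_in_nf; [apply/e | exists T'].
- move=> S; have [c|/nf_pos_Omega ->] := pselect (conv P');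
    last by move/conj_in_Omega.
  have c' := e.2 c.
  move=> /(conj_in_nf _ c)[T /((h c').2 _)[T' hT' r] ->].
  exists (pre_map (@nf_neg A) T'); last exact/pre_rel_map.
  by apply/conj_in_nf => //; exists T'.
Qed.

(** Normalisation leaves head variables in place. Hence a normal form has no reduction step, which
    gives [conv_nf] and [head_nf]. *)
Lemma nf_cut_free P S : conj_in S (nf_pos P) -> ~~ is_cut S.
Proof.
have [c|/nf_pos_Omega ->] := pselect (conv P); last by move/conj_in_Omega.
case/(conj_in_nf _ c) => -[[x|R] a N] [Q [_ _ //= _]] ->.
by [].
Qed.

Lemma conv_nf P : conv (nf_pos P) <-> conv P.
Proof.
split=> [/conv_neq h|c]; first by apply: contrapT => /nf_pos_Omega.
apply: Conv => [/nf_pos_Omega //|Q /stepE [S [/nf_cut_free/negbTE -> //]]].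
Qed.

Lemma head_nf P S : head (nf_pos P) S <-> conj_in S (nf_pos P).
Proof.
split=> [[Q [h hS nc]]|h]; last first.
  by exists (nf_pos P); split=> //; [apply: rt1n_refl | apply: nf_cut_free h].
case: h hS => // Q' Q'' /stepE [T [/nf_cut_free/negbTE -> //]].
Qed.

Definition nf_equiv P Q := eq_pos (nf_pos P) (nf_pos Q).
Definition nf_equiv_neg N M := eq_neg (nf_neg N) (nf_neg M).

(** The bisimulation pairs a normal form with its own normal form. The heads of [nf_pos P] are
    exactly the heads of [P] with normalised arguments, so the arguments fall back into the
    relation. *)
Lemma nf_idem_both :
  (forall P Q, (exists2 R, P = nf_pos R & Q = nf_pos P) -> eq_pos P Q) /\
  (forall N M, (exists2 K, N = nf_neg K & M = nf_neg N) -> eq_neg N M).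
Proof.
apply: eq_coind => [_ _ [P -> ->]|_ _ [N -> ->]].
  apply/nf_pos_rel; split; first exact: iff_sym (conv_nf P).
  move=> c.
  have rel S : pre_rel (fun N M => exists2 K,
      nf_neg N = nf_neg K & nf_neg M = nf_neg (nf_neg N))
      S (pre_map (@nf_neg A) S).
    case: S => N0 a N /=; split; first by exists N0.
    by exists erefl => k; exists (N k).
  split=> S hS.
    exists (pre_map (@nf_neg A) S) => //.
    by apply/head_nf/conj_in_nf => //; exists S.
  move/head_nf/(conj_in_nf _ c): hS => [T hT ->].
  by exists T.
case: N => [x|P]; first by left; rewrite !nf_neg_Var; apply: eq_Var.
by right; rewrite !nf_neg_Sum /= => a; exists (P a).
Qed.

Lemma nf_equiv_nf P : nf_equiv P (nf_pos P).
Proof. by apply: (proj1 nf_idem_both); exists P. Qed.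

Lemma nf_equiv_neg_nf N : nf_equiv_neg N (nf_neg N).
Proof. by apply: (proj2 nf_idem_both); exists N. Qed.

Lemma nf_equivE P P' : nf_equiv P P' ->
  (conv P <-> conv P') /\
  (conv P ->
    (forall S, head P S -> exists2 S', head P' S' & pre_rel nf_equiv_neg S S') /\
    (forall S', head P' S' -> exists2 S, head P S & pre_rel nf_equiv_neg S S')).
Proof. by move/eq_posE/nf_pos_rel. Qed.

Lemma nf_equiv_negE N M : nf_equiv_neg N M -> neg_rel nf_equiv N M.
Proof.
rewrite /nf_equiv_neg => /eq_negE; case: N M => [x|P] [y|Q];
  by rewrite ?nf_neg_Var ?nf_neg_Sum.
Qed.

Lemma nf_equiv_sym P Q : nf_equiv P Q -> nf_equiv Q P.
Proof. exact: eq_pos_sym. Qed.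

Lemma nf_equiv_neg_sym N M : nf_equiv_neg N M -> nf_equiv_neg M N.
Proof. exact: eq_neg_sym. Qed.

End NormalForm.

(** * The substitution closure as a bisimulation for normal forms *)

Section SubstitutionClosure.
Context {A : signature}.
Implicit Types (P Q : positive A) (S T : predesign A) (N M : negative A)
  (s t u : nat -> negative A).

Lemma conj_in_subst s S P : conj_in S P ->
  conj_in (pre_map (subst_neg s) S) (subst_pos s P).
Proof. by move=> h; rewrite subst_posE; apply/conj_in_map; exists S. Qed.

Lemma contract_subst s S : is_cut S ->
  is_cut (pre_map (subst_neg s) S) /\
  eq_pos (contract (pre_map (subst_neg s) S)) (subst_pos s (contract S)).
Proof.
by case: S => [[x|R] a N] //= _; split=> //; apply: subst_inst.
Qed.

Lemma step_subst s P Q : step P Q ->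
  exists2 Q', step (subst_pos s P) Q' & eq_pos Q' (subst_pos s Q).
Proof.
move=> /stepE [S [hS cS ->]]; have [c e] := contract_subst s cS.
exists (contract (pre_map (subst_neg s) S)) => //; apply/stepE.
by exists (pre_map (subst_neg s) S); split=> //; apply: conj_in_subst.
Qed.

Lemma steps_subst s P Q : steps P Q ->
  exists2 Q', steps (subst_pos s P) Q' & eq_pos Q' (subst_pos s Q).
Proof.
elim=> [P1|P1 Q1 R1 /(step_subst s) [Q' h e] _ [R' hs e']].
  by exists (subst_pos s P1); [apply: rt1n_refl | apply: eq_pos_refl].
have [R'' hs' e''] := steps_eq (eq_pos_sym e) hs.
exists R''; first exact: rt1n_trans h hs'.
exact: eq_pos_trans (eq_pos_sym e'') e'.
Qed.

(** A cut of the instance either comes from a cut of [P] or is created by [s] putting a sum in place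
    of a head variable. *)
Lemma step_subst_inv s P Q : step (subst_pos s P) Q ->
  (exists2 P', step P P' & eq_pos Q (subst_pos s P')) \/
  (exists S, [/\ conj_in S P, ~~ is_cut S, is_cut (pre_map (subst_neg s) S)
    & Q = contract (pre_map (subst_neg s) S)]).
Proof.
rewrite subst_posE => /stepE [_ [/conj_in_map [S hS ->] c ->]].
have [cS|ncS] := boolP (is_cut S); [left | by right; exists S].
exists (contract S); first by apply/stepE; exists S.
exact: (contract_subst s cS).2.
Qed.

(** Every reduction of [P] lifts to the instance. Steps lift only up to [eq_pos], so the induction
    runs over any [X] equal to the instance. *)
Lemma conv_subst_inv s P : conv (subst_pos s P) -> conv P.
Proof.
move E: (subst_pos s P) => X c.
have {E} e : eq_pos X (subst_pos s P) by rewrite E; apply: eq_pos_refl.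
elim: c P e => {}X nO _ IH P e; apply: Conv => [E|Q /(step_subst s) [Q' h e']].
  move/eq_posE/pos_relP: e => [[_ e] _ _]; apply/nO/e.
  by rewrite E subst_posE.
have [Q'' h'' e''] := step_eq (eq_pos_sym e) h.
apply: IH h'' _ _.
exact: eq_pos_trans (eq_pos_sym e'') e'.
Qed.

Lemma head_subst s P S : head P S -> ~~ is_cut (pre_map (subst_neg s) S) ->
  exists2 S', head (subst_pos s P) S' &
    pre_rel (@eq_neg A) (pre_map (subst_neg s) S) S'.
Proof.
move=> [Q [hs hS _]] nc; have [Q' hs' e] := steps_subst s hs.
have h : head (subst_pos s Q) (pre_map (subst_neg s) S).
  exists (subst_pos s Q); split=> //; first exact: rt1n_refl.
  exact: conj_in_subst.
have [S' hS' eS] := head_eq (eq_pos_sym e) h.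
by exists S' => //; apply: head_steps hs' hS'.
Qed.

(** The first step, to [Y], is isolated to show that the sequence is nonempty, as induction on the
    convergence of [X] requires. *)
Lemma head_fire s P X S : eq_pos X (subst_pos s P) -> head P S ->
  is_cut (pre_map (subst_neg s) S) ->
  exists2 Y, step X Y & exists2 Z, steps Y Z &
    eq_pos Z (contract (pre_map (subst_neg s) S)).
Proof.
move=> e [Q [hs hS _]] c.
have [Q' hs' e'] := steps_subst s hs.
have [X' hX eX] := steps_eq (eq_pos_sym e) hs'.
have st : step (subst_pos s Q) (contract (pre_map (subst_neg s) S)).
  apply/stepE; exists (pre_map (subst_neg s) S); split=> //.
  exact: conj_in_subst.
have [Z hZ eZ] := step_eq (eq_pos_trans (eq_pos_sym e') eX) st.
have [Y h1 h2] := steps_step hX hZ.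
by exists Y => //; exists Z => //; apply: eq_pos_sym.
Qed.

(** Substitutions may nest to any finite depth along each variable. Closure under [eq_neg] is built
    in because the composition laws hold only up to equality. *)
Inductive subst_closure : negative A -> negative A -> Prop :=
| subst_closure_var x : subst_closure (Var x) (Var x)
| subst_closure_subst N N' s s' M M' :
    nf_equiv_neg N N' -> (forall x, subst_closure (s x) (s' x)) ->
    eq_neg M (subst_neg s N) -> eq_neg M' (subst_neg s' N') ->
    subst_closure M M'.

Lemma nf_equiv_subst_closure N N' : nf_equiv_neg N N' -> subst_closure N N'.
Proof.
move=> h; apply: (subst_closure_subst h subst_closure_var);
  exact/eq_neg_sym/subst_neg_id.
Qed.

Definition subst_closure_pos P P' : Prop :=
  exists Q Q' s s',
    [/\ nf_equiv Q Q', forall x, subst_closure (s x) (s' x),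
        eq_pos P (subst_pos s Q) & eq_pos P' (subst_pos s' Q')].

Lemma subst_closure_sym N N' : subst_closure N N' -> subst_closure N' N.
Proof.
elim=> [x|{N N'}]; first exact: subst_closure_var.
move=> N N' s s' M M' e _ IH e1 e2.
by apply: (@subst_closure_subst N' N s' s) => //; apply: nf_equiv_neg_sym.
Qed.

Lemma subst_closure_pos_sym P P' : subst_closure_pos P P' -> subst_closure_pos P' P.
Proof.
case=> Q [Q' [s [s' [e h e1 e2]]]]; exists Q', Q, s', s; split=> //.
  exact: nf_equiv_sym.
by move=> x; apply: subst_closure_sym.
Qed.

(** By induction on the closure, the outer substitution is pushed into the values of the inner
    one. *)
Lemma subst_closure_comp N N' t t' : (forall x, subst_closure (t x) (t' x)) ->
  subst_closure N N' -> subst_closure (subst_neg t N) (subst_neg t' N').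
Proof.
move=> ht; elim=> [x|{N N'}]; first by rewrite !subst_Var.
move=> N N' s s' M M' e _ IH e1 e2.
apply: (@subst_closure_subst N N' (fun x => subst_neg t (s x))
  (fun x => subst_neg t' (s' x))) => //.
  by apply: eq_neg_trans (subst_neg_comp _ _ _);
    apply: subst_neg_eq e1 => x; apply: eq_neg_refl.
by apply: eq_neg_trans (subst_neg_comp _ _ _);
    apply: subst_neg_eq e2 => x; apply: eq_neg_refl.
Qed.

Lemma subst_closure_pos_comp P P' t t' : (forall x, subst_closure (t x) (t' x)) ->
  subst_closure_pos P P' -> subst_closure_pos (subst_pos t P) (subst_pos t' P').
Proof.
move=> ht [Q [Q' [s [s' [e h e1 e2]]]]].
exists Q, Q', (fun x => subst_neg t (s x)), (fun x => subst_neg t' (s' x)).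
split=> //.
- by move=> x; apply: subst_closure_comp.
- by apply: eq_pos_trans (subst_pos_comp _ _ _);
    apply: subst_pos_eq e1 => x; apply: eq_neg_refl.
- by apply: eq_pos_trans (subst_pos_comp _ _ _);
    apply: subst_pos_eq e2 => x; apply: eq_neg_refl.
Qed.

Lemma subst_closure_eq N N' M M' : eq_neg N M -> eq_neg N' M' ->
  subst_closure M M' -> subst_closure N N'.
Proof.
move=> e e' h; case: h e e' => [x|M1 M1' s s' {}M {}M' h hs e1 e1'] e e'.
  by move/eq_negE: e; move/eq_negE: e'; case: N N' => [y|?] [z|?] //= -> ->;
    apply: subst_closure_var.
by apply: (subst_closure_subst h hs);
  [apply: eq_neg_trans e1 | apply: eq_neg_trans e1'].
Qed.

(** The shift is a substitution of variables, so closure under substitution covers it. *)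
Lemma subst_closure_up k s s' : (forall x, subst_closure (s x) (s' x)) ->
  forall x, subst_closure (up_subst k s x) (up_subst k s' x).
Proof.
move=> h x; rewrite /up_subst; case: ifP => _; first exact: subst_closure_var.
apply: subst_closure_eq (ren_as_subst _ _) (ren_as_subst _ _) _.
by apply: subst_closure_comp (h _) => z; apply: subst_closure_var.
Qed.

(** If the substituted design is a variable, the induction hypothesis for its value applies; if it
    is a sum, the lifted substitutions act on equivalent components. *)
Lemma subst_closureE N N' : subst_closure N N' -> neg_rel subst_closure_pos N N'.
Proof.
elim=> [//|{N N'}] N N' s s' M M' /nf_equiv_negE + hs IH /eq_negE + /eq_negE.
case: N N' => [x|P] [y|Q] //=.
  move=> <-; rewrite !subst_Var; move: (IH x).
  case: (s x) (s' x) => [y'|R] [z|R'] //=; case: M M' => [v|K] [w|K'] //=.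
    by move=> -> -> ->.
  move=> h h1 h2 a; have [Q1 [Q1' [t [t' [e ht e1 e2]]]]] := h a.
  exists Q1, Q1', t, t'; split=> //; first exact: eq_pos_trans (h1 a) _.
  exact: eq_pos_trans (h2 a) _.
rewrite !subst_Sum; case: M M' => [v|K] [w|K'] //= h h1 h2 a.
exists (P a), (Q a), (up_subst (ar a) s), (up_subst (ar a) s'); split=> //.
exact: subst_closure_up.
Qed.

(** Related arguments give related instantiations, and the bodies of the two sums are related by
    [subst_closureE]. *)
Lemma subst_closure_contract S S' : pre_rel subst_closure S S' ->
  is_cut S = is_cut S' /\
  (is_cut S -> subst_closure_pos (contract S) (contract S')).
Proof.
case: S S' => N0 a N [M0 b M] /= [/subst_closureE + [e]].
case: _ / e M => M; case: N0 M0 => [x|P] [y|Q] //= h hk; split=> // _.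
apply: subst_closure_pos_comp => // x; rewrite /inst.
by case: insubP => // _; apply: subst_closure_var.
Qed.

Lemma subst_closure_pre s s' S S' : (forall x, subst_closure (s x) (s' x)) ->
  pre_rel nf_equiv_neg S S' ->
  pre_rel subst_closure (pre_map (subst_neg s) S) (pre_map (subst_neg s') S').
Proof.
move=> h e; apply/pre_rel_map; apply: pre_rel_mono e => N M e.
by apply: (subst_closure_subst e h); apply: eq_neg_refl.
Qed.

(* The outer induction, on the convergence of [X], only consumes steps that
   fire a head of [P]; the inner one follows the reductions internal to [P']. *)
Lemma subst_closure_conv_aux X : conv X -> forall Y, steps X Y ->
  forall P P' s s', nf_equiv P P' -> (forall x, subst_closure (s x) (s' x)) ->
  eq_pos Y (subst_pos s P) -> conv (subst_pos s' P').
Proof.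
(* The statement ranges over all reducts [Y] of [X] because firing a head may take several steps. If
   [Y] is at least one step away, the induction hypothesis applies at once. *)
elim=> {}X nO cX IH Y [|Y' Z hY hZ]; last exact: IH hY _ hZ.
move=> P P' s s' e hs eX.
have cP : conv P by apply/conv_subst_inv/(conv_eq eX)/Conv.
have [cc /(_ cP) [_ hd]] := nf_equivE e.
suff key P1' : conv P1' -> steps P' P1' -> conv (subst_pos s' P1').
  by apply: key; [apply/cc | apply: rt1n_refl].
elim=> {}P1' nO' _ IH' hP'; apply: Conv.
  by rewrite subst_posE => /pos_map_Omega.
move=> Q /step_subst_inv [[Q0 h0 eQ]|[S' [hS' ncS' cS' ->]]].
  by apply: conv_eq (eq_pos_sym eQ) _; apply: IH' (steps_rcons hP' h0).
have [|S hS eS] := hd S'; first by exists P1'.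
have [ec cl] := subst_closure_contract (subst_closure_pre hs eS).
rewrite -ec in cS'; have [Q1 [Q1' [t [t' [e1 ht e2 e2']]]]] := cl cS'.
(* Firing the matching head moves [X] to [X1], where the outer hypothesis covers the reduct [Z]. *)
have [X1 hX1 [Z hZ eZ]] := head_fire eX hS cS'.
apply: conv_eq (eq_pos_sym e2') _.
exact: IH hX1 _ hZ _ _ _ _ e1 ht (eq_pos_trans eZ e2).
Qed.

Lemma subst_closure_conv P P' : subst_closure_pos P P' -> conv P -> conv P'.
Proof.
case=> Q [Q' [s [s' [e h e1 e2]]]] c; apply: conv_eq (eq_pos_sym e2) _.
exact: subst_closure_conv_aux c _ (rt1n_refl _ _ _) _ _ _ _ e h e1.
Qed.

(** A reduct may have fewer heads than its source, so equivalence with [P'] is kept for the source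
    [P0] while [P] runs through the reducts of [P0]; a head of [P] is still a head of [P0]. *)
Lemma subst_closure_head_aux X Y S : steps X Y -> conj_in S Y -> ~~ is_cut S ->
  conv X -> forall P0 P P' s s', nf_equiv P0 P' -> conv P0 -> steps P0 P ->
  (forall x, subst_closure (s x) (s' x)) -> eq_pos X (subst_pos s P) ->
  exists2 S', head (subst_pos s' P') S' & pre_rel subst_closure S S'.
Proof.
move=> hXY hS ncS; elim: hXY hS => {X Y} [X|X X1 Y h _ IH] hS cX.
  move=> P0 P P' s s' e cP0 hP hs eX.
  have [_ hX _] := (pos_relP _ _ _).1 ((eq_posE _ _).1 eX).
  have [T hT eT] := hX _ hS; move: hT.
  rewrite subst_posE => /conj_in_map [U hU ET].
  have ncT : ~~ is_cut T by rewrite -(eq_contract eT).1.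
  have ncU : ~~ is_cut U.
    apply: contra ncT => cU; rewrite ET; exact: (contract_subst s cU).1.
  have [|U' hU' eU] := ((nf_equivE e).2 cP0).1 U; first by exists P.
  have r := subst_closure_pre hs eU; rewrite -ET in r.
  rewrite (subst_closure_contract r).1 in ncT.
  have [S' hS' eS'] := head_subst hU' ncT.
  exists S' => //.
  apply: pre_rel_mono (pre_rel_comp (pre_rel_comp eT r) eS') => N M.
  by case=> K [L e1 e2] e3; apply: subst_closure_eq e1 (eq_neg_sym e3) e2.
move=> P0 P P' s s' e cP0 hP hs eX.
have cX1 := conv_step cX h.
have [Z hZ eZ] := step_eq eX h.
(* For a step internal to [P], only [P] advances and [P'] waits. For a cut created by [s], the
   induction restarts from the two contracted cuts, with [Q] as both source and current reduct. *)
case/step_subst_inv: hZ => [[Q hQ eQ]|[U [hU ncU cU EZ]]].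
  apply: (IH hS cX1 P0 Q P' s s') => //; first exact: steps_rcons hP hQ.
  exact: eq_pos_trans eZ eQ.
have [|U' hU' eU] := ((nf_equivE e).2 cP0).1 U; first by exists P.
have [ec cl] := subst_closure_contract (subst_closure_pre hs eU).
have [Q [Q' [t [t' [e1 ht e2 e2']]]]] := cl cU; rewrite ec in cU.
have eX1 : eq_pos X1 (subst_pos t Q) by apply: eq_pos_trans e2; rewrite -EZ.
have cQ : conv Q by apply/conv_subst_inv/(conv_eq eX1).
have [S1 hS1 r1] := IH hS cX1 _ _ _ _ _ e1 cQ (rt1n_refl _ _ _) ht eX1.
(* The other side now catches up by firing the matching head [U'], and the head found after the
   contraction is pulled back along this reduction. *)
have [Y1 hY1 [Z1 hZ1 eZ1]] := head_fire (eq_pos_refl (subst_pos s' P')) hU' cU.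
have [S2 hS2 r2] := head_eq (eq_pos_trans (eq_pos_sym e2') (eq_pos_sym eZ1)) hS1.
exists S2.
  by apply: head_steps hS2; apply: rt1n_trans hY1 hZ1.
apply: pre_rel_mono (pre_rel_comp r1 r2) => N M [K r e'].
exact: subst_closure_eq (eq_neg_refl N) (eq_neg_sym e') r.
Qed.

Lemma subst_closure_head P P' S : subst_closure_pos P P' -> conv P ->
  head P S -> exists2 S', head P' S' & pre_rel subst_closure S S'.
Proof.
case=> Q [Q' [s [s' [e h e1 e2]]]] c [Y [hY hS ncS]].
have cQ : conv Q by apply/conv_subst_inv/(conv_eq e1).
have [S1 hS1 r1] := subst_closure_head_aux hY hS ncS c e cQ (rt1n_refl _ _ _) h e1.
have [S2 hS2 r2] := head_eq (eq_pos_sym e2) hS1.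
exists S2 => //; apply: pre_rel_mono (pre_rel_comp r1 r2) => N M [K r e'].
exact: subst_closure_eq (eq_neg_refl N) (eq_neg_sym e') r.
Qed.

Lemma subst_closure_nf :
  (forall P P', (exists Q Q', [/\ subst_closure_pos Q Q', P = nf_pos Q
      & P' = nf_pos Q']) -> eq_pos P P') /\
  (forall N N', (exists M M', [/\ subst_closure M M', N = nf_neg M
      & N' = nf_neg M']) -> eq_neg N N').
Proof.
apply: eq_coind => [_ _ [P [P' [r -> ->]]]|_ _ [N [N' [/subst_closureE r -> ->]]]].
  have r' := subst_closure_pos_sym r.
  apply/nf_pos_rel; split; first by split; apply: subst_closure_conv.
  move=> c; split=> S hS.
    have [S' hS' e] := subst_closure_head r c hS.
    by exists S' => //; apply: pre_rel_mono e => N M e; exists N, M.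
  (* The converse matching of heads comes from the symmetry of the closure. *)
  have [S' hS' e] := subst_closure_head r' (subst_closure_conv r c) hS.
  exists S' => //; apply: pre_rel_mono (pre_rel_sym e) => N M {}e.
  by exists N, M; split=> //; apply: subst_closure_sym.
case: N N' r => [x|P] [y|Q] //=; rewrite ?nf_neg_Var ?nf_neg_Sum.
  by move=> ->; left; apply: eq_Var.
by move=> h; right=> a; exists (P a), (Q a).
Qed.

(** Idempotence makes [P] equivalent to [nf_pos P], so the two instances lie in the closure. *)
Lemma nf_subst_pos s s' P : (forall x, nf_equiv_neg (s x) (s' x)) ->
  eq_pos (nf_pos (subst_pos s P)) (nf_pos (subst_pos s' (nf_pos P))).
Proof.
move=> h; apply: (proj1 subst_closure_nf).
exists (subst_pos s P), (subst_pos s' (nf_pos P)); split=> //.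
exists P, (nf_pos P), s, s'; split.
- exact: nf_equiv_nf.
- by move=> x; apply: nf_equiv_subst_closure.
- exact: eq_pos_refl.
- exact: eq_pos_refl.
Qed.

Lemma nf_subst_neg s s' N : (forall x, nf_equiv_neg (s x) (s' x)) ->
  eq_neg (nf_neg (subst_neg s N)) (nf_neg (subst_neg s' (nf_neg N))).
Proof.
move=> h; apply: (proj2 subst_closure_nf).
exists (subst_neg s N), (subst_neg s' (nf_neg N)); split=> //.
apply: subst_closure_comp (nf_equiv_subst_closure (nf_equiv_neg_nf N)) => x.
exact: nf_equiv_subst_closure.
Qed.

End SubstitutionClosure.

Theorem theorem1p12 (A : signature) (D : design A) (n : nat)
    (y : 'I_n -> nat) (N : 'I_n -> negative A) (y_distinct : injective y) :
  eq_design
    (nf (subst (simul y N) D))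
    (nf (subst (simul y (fun i => nf_neg (N i))) (nf D))).
Proof.
have h x : nf_equiv_neg (simul y N x) (simul y (fun i => nf_neg (N i)) x).
  rewrite /simul; case: pickP => [i _|_]; first exact: nf_equiv_neg_nf.
  exact: eq_neg_refl.
case: D => [P|S|M] /=; [exact: nf_subst_pos | | exact: nf_subst_neg].
(* A predesign is normalised as a unary conjunction; moving [unary] past the substitution reduces
   this case to the positive one. *)
have -> : unary (subst_pre (simul y N) S) = subst_pos (simul y N) (unary S).
  by rewrite subst_posE /unary /= subst_preE.
exact: nf_subst_pos.
Qed.
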